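(* Let $A$ be a finite nonempty alphabet and let $S\subset A^*$ be a uniformly recurrent connected set with $A\subset S$. Then for every $w\in S$, the set $\mathcal{R}_S(w)$ of first right return words to $w$ generates the free group $F_A$.
   Context: $A^+=A^*\setminus\{1\}$. $S$ is factorial if it contains all factors of its elements. For $w\in S$: $L(w)=\{a\in A\mid aw\in S\}$, $R(w)=\{a\in A\mid wa\in S\}$, $E(w)=\{(a,b)\mid awb\in S\}$; $S$ is biextendable if it is factorial and $E(w)\ne\emptyset$ for all $w\in S$; right-extendable if factorial and $R(w)\ne\emptyset$ for all $w$. The extension graph of $w$ is the undirected bipartite graph with vertex set the disjoint union of $L(w)$ and $R(w)$ and an edge $a$–$b$ for each $(a,b)\in E(w)$. $S$ is connected if it is biextendable and every extension graph is connected. $S$ is uniformly recurrent if it is right-extendable and for every $u\in S$ there is $n\ge1$ such that $u$ is a factor of every word of $S$ of length $n$. $\Gamma_S(w)=\{x\in S\mid wx\in S\cap A^+w\}$ and $\mathcal{R}_S(w)=\Gamma_S(w)\setminus\Gamma_S(w)A^+$. *)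

(* Defs.v *)
From HB Require Import structures.
From mathcomp Require Import all_boot.
From mathcomp Require Import boolp classical_sets.

Set Implicit Arguments.
Unset Strict Implicit.
Unset Printing Implicit Defensive.

Import Monoid.Theory Algebra.

Section FreeGroup.

Variable A : choiceType.

(* [(a, false)] stands for a and [(a, true)] for its formal inverse. *)
Definition signed_letter : Type := A * bool.

Definition letter_inv (x : signed_letter) : signed_letter := (x.1, ~~ x.2).

Definition reduced (s : seq signed_letter) : bool :=
  sorted (fun x y => y != letter_inv x) s.

(* [push x s] is the reduced form of [x :: s] when [s] is reduced. *)
Definition push (x : signed_letter) (s : seq signed_letter) :=
  if s is y :: s' then if y == letter_inv x then s' else x :: s
  else [:: x].

Definition free_reduce (s : seq signed_letter) := foldr push [::] s.

Lemma letter_invK : involutive letter_inv.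
Proof. by case=> a b; rewrite /letter_inv /= negbK. Qed.

Lemma reduced_cons x s : reduced (x :: s) -> reduced s.
Proof. by case: s => //= y s /andP[]. Qed.

Lemma push_reduced x s : reduced s -> reduced (push x s).
Proof.
case: s => [//|y s] rs /=; case: ifP => [_|/negbT yx].
  exact: reduced_cons rs.
by rewrite /reduced /= yx.
Qed.

Lemma foldr_push_reduced u s : reduced s -> reduced (foldr push s u).
Proof. by move=> rs; elim: u => //= x u; apply: push_reduced. Qed.

Lemma free_reduceP s : reduced (free_reduce s).
Proof. exact: foldr_push_reduced. Qed.

Lemma free_reduce_id s : reduced s -> free_reduce s = s.
Proof.
elim: s => //= x s IHs rs; rewrite IHs; last exact: reduced_cons rs.
by case: s rs {IHs} => //= y s /andP[/negbTE ->].
Qed.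

Lemma pushK x s : reduced s -> push x (push (letter_inv x) s) = s.
Proof.
case: s => [|y s] /=; first by rewrite eqxx.
rewrite letter_invK; case: eqP => [->|_ _] /=; last by rewrite eqxx.
by case: s => //= z s /andP[/negbTE ->].
Qed.

Lemma foldr_push_push x u s :
  reduced s -> foldr push s (push x u) = push x (foldr push s u).
Proof.
case: u => [//|y u] rs /=; case: eqP => [->|//].
by rewrite pushK //; apply: foldr_push_reduced.
Qed.

Lemma foldr_push_free_reduce u s :
  reduced s -> foldr push s (free_reduce u) = foldr push s u.
Proof. by move=> rs; elim: u => //= x u IHu; rewrite foldr_push_push // IHu. Qed.

Lemma free_reduce_catl u v : free_reduce (free_reduce u ++ v) = free_reduce (u ++ v).
Proof.
rewrite /free_reduce !foldr_cat -!/(free_reduce _).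
by rewrite foldr_push_free_reduce ?free_reduceP.
Qed.

Lemma free_reduce_catr u v : free_reduce (u ++ free_reduce v) = free_reduce (u ++ v).
Proof.
rewrite /free_reduce !foldr_cat -!/(free_reduce _).
by rewrite (free_reduce_id (free_reduceP v)).
Qed.

Definition word_inv (s : seq signed_letter) := rev (map letter_inv s).

Lemma word_invK : involutive word_inv.
Proof.
by move=> s; rewrite /word_inv map_rev revK mapK //; apply: letter_invK.
Qed.

Lemma foldr_push_word_inv u s :
  reduced s -> foldr push s (u ++ word_inv u) = s.
Proof.
elim: u s => //= x u IHu s rs.
rewrite /word_inv /= rev_cons -cats1 catA foldr_cat /= -/(word_inv u).
by rewrite IHu ?push_reduced // pushK.
Qed.

Record free_group :=
  FreeGroup { fg_val : seq signed_letter; fg_valP : reduced fg_val }.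

HB.instance Definition _ := [isSub for fg_val].
HB.instance Definition _ := [Choice of free_group by <:].

Definition fg_of_word s : free_group := FreeGroup (free_reduceP s).

Definition fg_one : free_group := fg_of_word [::].
Definition fg_mul (x y : free_group) := fg_of_word (fg_val x ++ fg_val y).
Definition fg_inv (x : free_group) := fg_of_word (word_inv (fg_val x)).

Lemma fg_mulA : associative fg_mul.
Proof.
by move=> x y z; apply: val_inj; rewrite /= free_reduce_catl free_reduce_catr catA.
Qed.

Lemma fg_mul1 : left_id fg_one fg_mul.
Proof. by move=> x; apply: val_inj => /=; apply: free_reduce_id; case: x. Qed.

Lemma fg_mulr1 : right_id fg_one fg_mul.
Proof.
by move=> x; apply: val_inj; rewrite /= cats0; apply: free_reduce_id; case: x.
Qed.

Lemma fg_mulV : left_inverse fg_one fg_inv fg_mul.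
Proof.
move=> x; apply: val_inj; rewrite /= free_reduce_catl -{2}(word_invK (fg_val x)).
exact: foldr_push_word_inv.
Qed.

Lemma fg_mulrV : right_inverse fg_one fg_inv fg_mul.
Proof.
by move=> x; apply: val_inj; rewrite /= free_reduce_catr; apply: foldr_push_word_inv.
Qed.

HB.instance Definition _ := isGroup.Build free_group
  fg_mulA fg_mul1 fg_mulr1 fg_mulV fg_mulrV.

Definition fg_gen (a : A) : free_group := fg_of_word [:: (a, false)].

Definition fg_word (w : seq A) : free_group := (\prod_(a <- w) fg_gen a)%g.

Section UniversalProperty.

Variables (G : groupType) (f : A -> G).

Local Open Scope group_scope.

Definition fg_lift_letter (x : signed_letter) : G :=
  if x.2 then (f x.1)^-1 else f x.1.

Definition fg_lift (x : free_group) : G :=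
  \prod_(y <- fg_val x) fg_lift_letter y.

Lemma fg_lift_letter_inv x : fg_lift_letter (letter_inv x) = (fg_lift_letter x)^-1.
Proof. by case: x => a [] //=; rewrite /fg_lift_letter /= invgK. Qed.

Lemma prod_free_reduce s :
  \prod_(y <- free_reduce s) fg_lift_letter y = \prod_(y <- s) fg_lift_letter y.
Proof.
elim: s => //= x s IHs; rewrite [RHS]big_cons -IHs.
case: (free_reduce s) => [|y t] /=; first by rewrite big_seq1 big_nil mulg1.
by case: eqP => [->|_]; rewrite !big_cons // fg_lift_letter_inv mulgA mulgV mul1g.
Qed.

Lemma fg_liftM : {morph fg_lift : x y / x * y}.
Proof. by move=> x y; rewrite /fg_lift prod_free_reduce big_cat. Qed.

Lemma fg_lift_gen a : fg_lift (fg_gen a) = f a.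
Proof. exact: big_seq1. Qed.

Lemma fg_lift_unique (h : free_group -> G) :
  {morph h : x y / x * y} -> (forall a, h (fg_gen a) = f a) -> h =1 fg_lift.
Proof.
move=> hM hgen.
have h1 : h 1 = 1 by apply: (@mulgI _ (h 1)); rewrite -hM !mulg1.
have hV x : h x^-1 = (h x)^-1.
  by apply: (@mulgI _ (h x)); rewrite -hM !mulgV.
suff hw s : h (fg_of_word s) = \prod_(y <- s) fg_lift_letter y.
  move=> x; rewrite /fg_lift -hw; congr h; apply: val_inj => /=.
  by rewrite free_reduce_id //; case: x.
elim: s => [|[a b] s IHs]; first by rewrite big_nil -h1.
have -> : fg_of_word ((a, b) :: s) = fg_of_word [:: (a, b)] * fg_of_word s.
  by apply: val_inj; apply/esym/(free_reduce_catr [:: (a, b)]).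
rewrite hM IHs big_cons; congr (_ * _).
by case: b => //=; rewrite /fg_lift_letter /= -hgen // -hV; congr h; apply: val_inj.
Qed.

End UniversalProperty.

End FreeGroup.

Local Open Scope classical_set_scope.

Definition generates (G : groupType) (X : set G) : Prop :=
  smallest (fun H : set G => group_closed [in H]) X = setT.

Section Words.

Variable A : finType.

Implicit Types (S X Y : set (seq A)) (u v w x : seq A).

Definition Aplus : set (seq A) := [set v | v <> [::]].

Definition lang_prod X Y : set (seq A) := [set x ++ y | x in X & y in Y].

Definition factorial_set S : Prop := forall u v, infix u v -> S v -> S u.

Definition left_ext S w : set A := [set a | S (a :: w)].

Definition right_ext S w : set A := [set a | S (rcons w a)].

Definition bi_ext S w : set (A * A) := [set p | S (p.1 :: rcons w p.2)].

Definition biextendable S : Prop :=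
  factorial_set S /\ forall w, S w -> bi_ext S w !=set0.

Definition right_extendable S : Prop :=
  factorial_set S /\ forall w, S w -> right_ext S w !=set0.

(* The extension graph of w lives in the disjoint union [A + A]: its vertices
   are the [inl a] with a in L(w) and the [inr b] with b in R(w). *)
Definition ext_vertices S w : set (A + A) :=
  [set z | match z with inl a => left_ext S w a | inr b => right_ext S w b end].

Definition ext_edge S w : rel (A + A) := fun y z =>
  match y, z with
  | inl a, inr b | inr b, inl a => (a, b) \in bi_ext S w
  | _, _ => false
  end.

(* When S is factorial, [ext_edge] only relates vertices of the graph, so a
   path in [A + A] between two vertices stays inside the graph. *)
Definition ext_graph_connected S w : Prop :=
  forall y z, ext_vertices S w y -> ext_vertices S w z ->
    connect (ext_edge S w) y z.

Definition connected_set S : Prop :=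
  biextendable S /\ forall w, S w -> ext_graph_connected S w.

Definition uniformly_recurrent S : Prop :=
  right_extendable S /\
  forall u, S u ->
    exists n, 1 <= n /\ forall v, S v -> size v = n -> infix u v.

Definition right_returns S w : set (seq A) :=
  [set x | S x /\ (S `&` lang_prod Aplus [set w]) (w ++ x)].

Definition first_right_returns S w : set (seq A) :=
  right_returns S w `\` lang_prod (right_returns S w) Aplus.

End Words.

(* Main.v *)
Require Import Defs.
From mathcomp Require Import all_boot.
From mathcomp Require Import boolp classical_sets.

(** Let H be a subgroup containing the first right returns to w. Label a word u
    of S having w as a factor by the coset H t, where u = p w t with p as long
    as possible. Appending a letter a to u multiplies the label by a on the
    right: if a new occurrence of w appears, then t a is a first right return.
    By uniform recurrence there is an m such that the label of a long word only
    depends on its suffix of length m. Connectedness of the extension graphs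
    lowers m step by step to 0: an extension edge pair auc, buc gives labels
    with f(au) c = f(auc) = f(buc) = f(bu) c, since auc and buc share the suffix
    uc, and then c cancels. So all long words have the same label, which is H
    for those ending with w, and H a = H for every letter a. *)

Local Open Scope classical_set_scope.

(** * Labelling long words by right cosets of a subgroup *)

Section CosetLabelling.

Local Open Scope group_scope.

Context {A : finType} (S : set (seq A)) {G : groupType} (H : {pred G}).
Context (g : A -> G) (f : seq A -> G) (m : nat).

Hypothesis gH : group_closed H.
Hypothesis biS : biextendable S.
Hypothesis f_rcons : forall u a, m <= size u -> S (rcons u a) ->
  f (rcons u a) / (f u * g a) \in H.
Hypothesis f_cons : forall b u, m <= size u -> S (b :: u) -> f (b :: u) = f u.

(** This is [H x = H y]: right cosets, so that multiplication on the right acts on them and can be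
    cancelled. *)
Let same_coset x y := x / y \in H.

Lemma same_coset_refl x : same_coset x x.
Proof. by rewrite /same_coset divgg; case: gH. Qed.

Lemma same_coset_sym x y : same_coset x y -> same_coset y x.
Proof.
by move=> xy; rewrite /same_coset -[y / x]invgK invgF; apply: group_closedV.
Qed.

Lemma same_coset_trans y x z : same_coset x y -> same_coset y z -> same_coset x z.
Proof.
move=> xy yz; rewrite /same_coset -[x](mulgVK y) -mulgA.
exact: group_closedM.
Qed.

Lemma same_coset_mulr c x y : same_coset (x * c) (y * c) = same_coset x y.
Proof. by rewrite /same_coset invgM mulgA mulgK. Qed.

Lemma factorial_catr u v : S (u ++ v) -> S v.
Proof. by case: biS => fS _; apply: fS; apply: infix_catl; apply: infix_refl. Qed.

Lemma long_left_extension n u : S u -> exists2 z, S (z ++ u) & n <= size z.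
Proof.
move=> Su; elim: n => [|n [z Sz le_nz]]; first by exists [::].
case: biS => fS /(_ _ Sz)[[a b] /= Sab]; exists (a :: z) => //.
by apply: fS Sab; rewrite -cats1 -cat_cons infix_catr ?infix_refl.
Qed.

(** The bound [m] concerns the whole words, where [f_rcons] and [f_cons] apply; the suffix [u]
    itself may shrink to the empty word. *)
Definition determined_by_suffix k := forall u x y, size u = k ->
  S (x ++ u) -> S (y ++ u) -> m <= size (x ++ u) -> m <= size (y ++ u) ->
  same_coset (f (x ++ u)) (f (y ++ u)).

Lemma determined_by_suffix_base : determined_by_suffix m.
Proof.
move=> u x y szu.
have fu z : S (z ++ u) -> f (z ++ u) = f u.
  elim: z => //= b z IHz Sbzu; rewrite f_cons ?size_cat ?szu ?leq_addl //.
  by apply: IHz; apply: (@factorial_catr [:: b]).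
by move=> Sx Sy _ _; rewrite !fu ?same_coset_refl.
Qed.

Lemma determined_by_suffix_pred k : k < m ->
  (forall u, S u -> ext_graph_connected S u) ->
  determined_by_suffix k.+1 -> determined_by_suffix k.
Proof.
move=> lt_km connS IH u x y szu Sx Sy mx my.
have nilN z : m <= size (z ++ u) -> z <> [::].
  by move=> + z0; rewrite z0 szu leqNgt lt_km.
case/lastP: x => [|x a] in Sx mx *; first by case: (nilN _ mx).
case/lastP: y => [|y b] in Sy my *; first by case: (nilN _ my).
rewrite !cat_rcons in Sx Sy mx my *.
have Su : S u by apply: (@factorial_catr (rcons x a)); rewrite cat_rcons.
(* With [u] fixed, [a] is to be linked to [b] along a path in the extension graph of [u]. *)
pose agree a b := forall x y, S (x ++ a :: u) -> S (y ++ b :: u) ->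
  m <= size (x ++ a :: u) -> m <= size (y ++ b :: u) ->
  same_coset (f (x ++ a :: u)) (f (y ++ b :: u)).
have long v d : m <= size v -> m <= size (v ++ d :: u).
  by move=> mv; rewrite size_cat (leq_trans mv) ?leq_addr.
(* [agree] would be vacuous without a long word ending in [b' :: u], so the middle letter must
   satisfy [S (b' :: u)]. *)
have agree_trans b' a' c' : S (b' :: u) -> agree a' b' -> agree b' c' -> agree a' c'.
  move=> Sb ab bc x' y' Sx' Sy' mx' my'.
  have [z Sz mz] := @long_left_extension m _ Sb.
  have mz' := long _ b' mz.
  exact: same_coset_trans (ab _ _ Sx' Sz mx' mz') (bc _ _ Sz Sy' mz' my').
have agree_refl a' : agree a' a' by move=> x' y'; apply: IH; rewrite /= szu.
have agree_edge a' b' c : S (a' :: rcons u c) -> S (b' :: rcons u c) -> agree a' b'.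
  move=> Sac Sbc.
  have [z Sz mz] := @long_left_extension m _ Sac.
  have [z' Sz' mz'] := @long_left_extension m _ Sbc.
  have drop_c v d : S (v ++ d :: rcons u c) -> S (v ++ d :: u).
    case: biS => fS _; apply: fS.
    by rewrite -rcons_cons -rcons_cat; apply: infix_rcons.
  have ab : same_coset (f (z ++ a' :: u)) (f (z' ++ b' :: u)).
    rewrite -(same_coset_mulr (g c)).
    have fac : same_coset (f (z ++ a' :: rcons u c)) (f (z ++ a' :: u) * g c).
      by rewrite -rcons_cons -rcons_cat; apply: f_rcons; rewrite ?long // rcons_cat.
    have fbc : same_coset (f (z' ++ b' :: rcons u c)) (f (z' ++ b' :: u) * g c).
      by rewrite -rcons_cons -rcons_cat; apply: f_rcons; rewrite ?long // rcons_cat.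
    apply: same_coset_trans (same_coset_sym _ _ fac) _.
    apply: same_coset_trans fbc.
    (* Both words end in [rcons u c], of length [k.+1], as the induction hypothesis requires. *)
    rewrite -!(cat_rcons _ _ (rcons u c)).
    by apply: IH; rewrite ?cat_rcons ?size_rcons ?szu // size_cat
      (leq_trans _ (leq_addr _ _)).
  move=> x' y' Sx' Sy' mx' my'.
  apply: same_coset_trans (agree_refl a' _ _ Sx' (drop_c _ _ Sz) mx' (long _ _ mz)) _.
  apply: same_coset_trans ab _.
  exact: agree_refl (drop_c _ _ Sz') Sy' (long _ _ mz') my'.
have Sau : S (a :: u) by apply: factorial_catr Sx.
have Sbu : S (b :: u) by apply: factorial_catr Sy.
suff: agree a b by apply.
have /connectP[p pth lst] := connS u Su (inl a) (inl b) Sau Sbu.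
(* The graph is bipartite, so the path is consumed two edges at a time, from [inl a] through [inr c]
   to [inl a']; hence strong induction on its length. *)
elim/ltn_ind: {p}(size p) {-2}p (erefl (size p)) a {x Sx mx} Sau pth lst
  => n IHn p szp a Sau pth lst.
case: p szp pth lst => [_ _ [->] //|[//|c] [//|[a'|c'] p]] /= szp;
  last by rewrite andbF.
case/and3P; rewrite /in_mem /= !asboolE /= => Sac Sa'c pth lst.
have Sa' : S (a' :: u).
  by case: biS => fS _; apply: fS Sa'c; rewrite -rcons_cons infix_rcons.
apply: (agree_trans a') => //; first exact: agree_edge Sac Sa'c.
by apply: IHn (erefl (size p)) _ Sa' pth lst; rewrite -szp.
Qed.

Lemma label_constant x y : (forall u, S u -> ext_graph_connected S u) ->
  S x -> S y -> m <= size x -> m <= size y -> same_coset (f x) (f y).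
Proof.
move=> connS Sx Sy mx my.
(* After [m] reductions the common suffix is empty and no longer restricts the words. *)
have step n : n <= m -> determined_by_suffix (m - n).
  elim: n => [_|n IHn lt_nm]; first by rewrite subn0; apply: determined_by_suffix_base.
  apply: determined_by_suffix_pred; rewrite ?subnSK //; last exact/IHn/ltnW.
  exact: leq_subr.
have := step m (leqnn m); rewrite subnn => /(_ [::] x y erefl).
by rewrite !cats0; apply.
Qed.

End CosetLabelling.

(** * What follows the last occurrence of a word *)

Section ReturnTail.

Context {A : finType} (w : seq A).

(** The value is meaningful only if [w] occurs in [u]: it is then the part after the last
    occurrence. *)
Fixpoint return_tail (u : seq A) : seq A :=
  if u is _ :: u' then
    if infix w u' then return_tail u' else drop (size w) u
  else [::].

Lemma return_tail_new u a :
  infix w (rcons u a) -> ~~ infix w u -> return_tail (rcons u a) = [::].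
Proof.
elim: u => [|b u IHu]; first by rewrite infixs1 infixs0 /= => /orP[|] /eqP->.
rewrite rcons_cons !infix_consl negb_or => /orP[pre|iw] /andP[npre nw] /=;
  last by rewrite iw IHu.
case: ifP => iw; first exact: IHu.
case/prefixP: pre => v def; case/lastP: v def => [|v c].
  by rewrite cats0 -rcons_cons => ->; rewrite drop_size.
rewrite -rcons_cons -rcons_cat => /rcons_inj[def _].
by rewrite def prefix_prefix in npre.
Qed.

Lemma return_tail_suffix_w v : return_tail (v ++ w) = [::].
Proof.
elim: v => [|b v IHv] /=; last by rewrite infix_catl ?infix_refl.
suff tail0 u : size u = size w -> return_tail u = [::] by exact: tail0.
case: u => //= b u szu; case: ifP => [/size_infix|_]; first by rewrite -szu ltnn.
by rewrite drop_oversize //= szu.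
Qed.

(** A shorter return [x], with [rcons t a = x ++ y] and [y] nonempty, would give an occurrence of
    [w] inside [w ++ t] other than the initial one, since the last letter of [y] is [a]. *)
Lemma first_right_returns_intro S t a v : factorial_set S ->
  S (w ++ rcons t a) -> v <> [::] -> w ++ rcons t a = v ++ w ->
  (forall z y, w ++ t = z ++ w ++ y -> z = [::]) ->
  first_right_returns S w (rcons t a).
Proof.
move=> fS Swta vN0 def no_earlier; split.
  split; last by split=> //; exists v => //; exists w.
  by apply: fS Swta; rewrite infix_catl ?infix_refl.
case=> x [_ [_ [z zN0 [_ -> wx]]]] [y yN0 xy].
case/lastP: y yN0 xy => // y c _; rewrite -rcons_cat => /rcons_inj[xy _].
by apply: zN0; apply: (no_earlier _ y); rewrite -xy catA -wx -catA.
Qed.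

Lemma return_tail_rcons S u a : factorial_set S -> S (rcons u a) -> infix w u ->
  return_tail (rcons u a) = rcons (return_tail u) a \/
  return_tail (rcons u a) = [::] /\
    first_right_returns S w (rcons (return_tail u) a).
Proof.
move=> fS; elim: u => [|b u IHu] Su.
  (* Here [w] is empty, and every single letter is a first return. *)
  rewrite infixs0 => /eqP w0; right; split; first by rewrite /= w0.
  by apply: (@first_right_returns_intro _ [::] _ [:: a]); rewrite ?w0 //; case.
rewrite infix_consl.
have [iw _|niw] := boolP (infix w u).
  rewrite /= iw (infix_trans iw (infix_rcons _ _)); apply: IHu => //.
  by apply: fS Su; rewrite rcons_cons infix_cons.
(* Now [b :: u] begins with the last occurrence of [w], so a later one in [rcons u a] must end at
   [a]. *)
rewrite orbF => /prefixP[t def] /=.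
rewrite (negPf niw) def drop_size_cat // -rcons_cons def rcons_cat drop_size_cat //.
have [iw|_] := boolP (infix w (rcons u a)); last by left.
right; split; first exact: return_tail_new.
have [v def_u] : exists v, rcons u a = v ++ w.
  by apply/suffixP; move: iw; rewrite infix_rconsl (negPf niw) orbF.
apply: (@first_right_returns_intro _ _ _ (b :: v)) => //.
- by rewrite -rcons_cat -def.
- by rewrite -rcons_cat -def rcons_cons def_u.
move=> [//|c z] y; rewrite -def => -[_ def'].
by rewrite def' infix_infix in niw.
Qed.

End ReturnTail.

(** * Generation of the free group *)

Lemma fg_gen_generate {A : choiceType} (H : {pred free_group A}) :
  group_closed H -> (forall a, fg_gen a \in H) -> forall x, x \in H.
Proof.
move=> gH genH x.
suff wordH s : fg_of_word s \in H.
  have -> : x = fg_of_word (fg_val x); last exact: wordH.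
  by apply: val_inj; rewrite /= free_reduce_id //; apply: fg_valP.
elim: s => [|[a b] s IHs]; first by case: gH.
have -> : fg_of_word ((a, b) :: s) = (fg_of_word [:: (a, b)] * fg_of_word s)%g.
  by apply: val_inj; apply/esym/(free_reduce_catr [:: (a, b)]).
apply: (group_closedM gH) IHs; case: b; last exact: genH.
have -> : fg_of_word [:: (a, true)] = (fg_gen a)^-1%g by apply: val_inj.
exact: group_closedV.
Qed.

Theorem theorem4p7 (A : finType) (S : set (seq A))
  (A_nonempty : (0 < #|A|)%N)
  (S_uniformly_recurrent : uniformly_recurrent S)
  (S_connected : connected_set S)
  (A_sub_S : forall a : A, S [:: a])
  (w : seq A) (Sw : S w) :
  generates [set fg_word x | x in first_right_returns S w].
Proof.
have [biS connS] := S_connected.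
have fS := biS.1.
have [_ /(_ _ Sw)[m [_ rec]]] := S_uniformly_recurrent.
have long_infix u : S u -> m <= size u -> infix w u.
  move=> Su mu; apply: infix_trans (infix_take u m).
  by apply: rec; rewrite ?size_takel //; apply: fS Su; apply: infix_take.
apply/seteqP; split=> // x _ H [/= gH subH].
have fg_wordD u v : fg_word (u ++ v) = (fg_word u * fg_word v)%g by apply: big_cat.
have fg_word1 a : fg_word [:: a] = fg_gen a :> free_group A by apply: big_seq1.
pose f u : free_group A := fg_word (return_tail w u).
have H1 : (1%g : free_group A) \in H by case: gH.
have f_cons b u : m <= size u -> S (b :: u) -> f (b :: u) = f u.
  move=> mu Sbu; rewrite /f /= long_infix //.
  by apply: fS Sbu; apply: infix_cons.
have f_rcons u a : m <= size u -> S (rcons u a) ->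
    (f (rcons u a) / (f u * fg_gen a))%g \in H.
  move=> mu Sua.
  have Su : S u by apply: fS Sua; apply: infix_rcons.
  rewrite /f -fg_word1 -fg_wordD cats1.
  have [->|[-> ret]] := return_tail_rcons _ _ _ _ fS Sua (long_infix _ Su mu).
    by rewrite divgg.
  (* The new label is 1, so the quotient is the inverse of the image of a first return. *)
  rewrite [fg_word [::]]big_nil div1g; apply: (group_closedV gH).
  by rewrite inE; apply: subH; exists (rcons (return_tail w u) a).
have const := label_constant _ _ _ _ _ gH biS f_rcons f_cons _ _ connS.
(* A long word ending with [w] has label 1; constancy then puts every label in [H]. *)
have [z Szw mz] := long_left_extension _ biS m _ Sw.
have mzw : m <= size (z ++ w) by rewrite size_cat (leq_trans mz) ?leq_addr.
have fH u : S u -> m <= size u -> f u \in H.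
  move=> Su mu; have := const _ _ Su Szw mu mzw.
  by rewrite {2}/f return_tail_suffix_w [fg_word _]big_nil divg1.
have genH a : fg_gen a \in H.
  (* Both [v] and [rcons v a] are long enough to have labels in [H], and these differ by [fg_gen a]
     modulo [H]. *)
  have [v Sva mv] := long_left_extension _ biS m _ (A_sub_S a).
  rewrite cats1 in Sva.
  have Sv : S v by apply: fS Sva; apply: infix_rcons.
  have fva := fH _ Sva ltac:(by rewrite size_rcons ltnW).
  have fvaH : (f v * fg_gen a)%g \in H.
    rewrite -[X in X \in H]invgK -[X in (X^-1)%g \in H]mul1g.
    apply: (group_closedV gH).
    rewrite -[1%g](mulVg (f (rcons v a))) -mulgA.
    by apply: (group_closedM gH); [apply: (group_closedV gH)|apply: f_rcons].
  rewrite -[fg_gen a](mulKg (f v)).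
  by apply: (group_closedM gH) => //; apply: (group_closedV gH); apply: fH.
by rewrite -inE; apply: fg_gen_generate gH genH x.
Qed.
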